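(* Let $G$ be a solvable finite group. Then $G$ is semiprime-cyclic if and only if $G$ is freely representable.
   Context: A finite group $G$ is semiprime-cyclic if every subgroup $H \subseteq G$ whose order is a product of two primes (possibly equal) is cyclic. A free linear representation of a group $G$ over a field $F$ is a linear action of $G$ on an $F$-vector space $V \neq 0$ such that $gv \neq v$ for all $g \neq 1$ in $G$ and all nonzero $v \in V$. A finite group is freely representable if it has a free linear representation over $\mathbb{C}$. *)

(* Defs.v *)
From mathcomp Require Import all_boot all_order all_algebra.
From mathcomp Require Import all_fingroup all_solvable.
From mathcomp Require Import reals complex.

Set Implicit Arguments.
Unset Strict Implicit.
Unset Printing Implicit Defensive.

Import GRing.Theory.
Local Open Scope ring_scope.

Definition semiprime_cyclic (gT : finGroupType) (G : {group gT}) : Prop :=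
  forall H : {group gT}, H \subset G ->
    (exists p q : nat, [/\ prime p, prime q & #|H| = (p * q)%N]) -> cyclic H.

(* The values of rho outside G are irrelevant. *)
Definition linear_action (F : fieldType) (gT : finGroupType) (G : {group gT})
    (V : lmodType F) (rho : gT -> {linear V -> V}) : Prop :=
  (forall v : V, rho 1%g v = v) /\
  (forall g h : gT, g \in G -> h \in G ->
     forall v : V, rho (g * h)%g v = rho g (rho h v)).

(* V is an arbitrary nonzero vector space, possibly infinite-dimensional. *)
Definition free_linear_representation (F : fieldType) (gT : finGroupType)
    (G : {group gT}) (V : lmodType F) (rho : gT -> {linear V -> V}) : Prop :=
  [/\ exists v : V, v != 0,
      linear_action G rho
    & forall g : gT, g \in G -> g != 1%g ->
        forall v : V, v != 0 -> rho g v != v].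

(* The field of complex numbers is R[i], for R any model of the reals. *)
Definition freely_representable (R : realType) (gT : finGroupType)
    (G : {group gT}) : Prop :=
  exists (V : lmodType R[i]) (rho : gT -> {linear V -> V}),
    free_linear_representation G rho.

(* Main.v *)
Require Import Defs.
From HB Require Import structures.
From mathcomp Require Import all_boot all_order all_algebra.
From mathcomp Require Import all_fingroup all_solvable all_field.
From mathcomp Require Import reals complex.

(** A representation of G on V is free exactly when every element c of prime
    order satisfies sum_(y in <[c]>) y = 0 on V.  If H is a noncyclic subgroup
    of order p q, its subgroups of prime order partition H^#, and summing these
    relations over all of them makes a nonzero multiple of every v vanish.

    Conversely, G is freely representable as soon as some nonzero f : G -> C
    satisfies sum_(y in <[c]>) f (y x) = 0 for all x and all c of prime order:
    such functions form a free representation under left translation.  It is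
    enough to find f on a subgroup N containing all elements of prime order, and
    to extend it by 0.  An element of prime order centralises every subgroup of
    prime order it normalises, hence by coprime action every cyclic normal
    subgroup.  As 'O_p(G) is cyclic, or p = 2 and it is generalised quaternion,
    the elements of prime order all lie in the cyclic group Z = 'C_G('F(G)) and
    f is a faithful character of Z, unless Q = 'O_2(G) is Q_8 and some element
    of order 3 acts nontrivially on Q.  In that case N = Q Z <c>, for any such
    c, is a central product of Z and SL(2, 3), and f is the character of a
    2-dimensional representation of N. *)

Set Implicit Arguments.
Unset Strict Implicit.
Unset Printing Implicit Defensive.

Import GroupScope GRing.Theory Num.Theory.

(** * Free representations *)

Lemma prime_dvdn_semiprime p q d :
  prime p -> prime q -> d %| p * q -> d != 1%N -> d != (p * q)%N -> prime d.
Proof.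
move=> p_pr q_pr d_pq d1 d_neq; have dvd_q e : e %| q -> e = 1%N \/ e = q.
  by case/primeP: q_pr => _ D /D /pred2P.
have [/dvdnP[e De] | p'd] := boolP (p %| d).
  have: e %| q by rewrite -(dvdn_pmul2l (prime_gt0 p_pr)) mulnC -De.
  case/dvd_q=> De1; first by rewrite De De1 mul1n.
  by rewrite De De1 mulnC eqxx in d_neq.
have: d %| q by rewrite -(@Gauss_dvdr d p) // coprime_sym prime_coprime.
by case/dvd_q=> Dd; [rewrite Dd in d1 | rewrite Dd].
Qed.

Section FreeAction.

Variables (F : numFieldType) (gT : finGroupType) (G : {group gT}).
Variables (V : lmodType F) (rho : gT -> {linear V -> V}).
Hypothesis freeV : free_linear_representation G rho.

(** The sum is fixed by all of [H], so freeness at one nontrivial element kills it. *)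
Lemma free_norm0 (H : {group gT}) (v : V) :
  H \subset G -> H :!=: 1 -> (\sum_(h in H) rho h v = 0)%R.
Proof.
move=> sHG /trivgPn[g Hg g1]; have [_ [_ rhoM] free] := freeV.
apply/eqP; set w := (\sum_(h in H) _)%R; apply/negPn/negP => w0.
case/negP: (free g (subsetP sHG g Hg) g1 w w0); apply/eqP.
rewrite linear_sum [RHS](reindex_inj (mulgI g)) /=.
by apply: eq_big => [h | h Hh]; rewrite ?groupMl // -rhoM ?(subsetP sHG).
Qed.

(* The proper cyclic subgroups <[x]>, x != 1, partition H^#, and each of them
   contributes -v to the sum of all rho h v. *)
Lemma free_semiprime_cyclic : semiprime_cyclic G.
Proof.
move=> H sHG [p [q [p_pr q_pr oH]]]; apply: contraT => /= ncycH.
have [[v v0] [rho1 rhoM] free] := freeV.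
have sum1 (K : {group gT}) :
  K \subset G -> K :!=: 1 -> (\sum_(h in K^#) rho h v = - v)%R.
  move=> sKG ntK; apply/eqP; rewrite -addr_eq0 addrC -{1}(rho1 v).
  by rewrite -[X in _ == X](free_norm0 v sKG ntK) [X in _ == X](big_setD1 1) ?group1.
have o_pr x : x \in H^# -> prime #[x].
  case/setD1P=> x1 Hx; apply: (prime_dvdn_semiprime p_pr q_pr).
  - by rewrite -oH order_dvdG.
  - by rewrite order_eq1.
  apply: contra ncycH => /eqP oxH; apply/cyclicP; exists x; apply/eqP.
  by rewrite eq_sym eqEcard cycle_subG Hx oH -oxH -orderE leqnn.
have ntH: H :!=: 1.
  by rewrite -cardG_gt1 oH (leq_trans (prime_gt1 p_pr)) ?leq_pmulr ?prime_gt0.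
pose D := [set <[x]> | x in H^#].
have : (\sum_(h in H^#) rho h v = - v *+ #|D|)%R.
  rewrite (partition_big (fun x => <[x]>) (mem D)) /=; last first.
    by move=> x Hx; apply: imset_f.
  rewrite -sumr_const; apply: eq_bigr => _ /imsetP[x Hx ->].
  have [x1 Hx'] := setD1P Hx; have ntx : <[x]> != 1 by rewrite cycle_eq1.
  rewrite -(sum1 <[x]>%G) ?cycle_subG ?(subsetP sHG) //.
  apply: eq_bigl => y; apply/andP/setD1P => [[/setD1P[y1 Hy] /eqP Ey] | [y1 xy]].
    by rewrite y1 /= -Ey cycle_id.
  have sxH: <[x]> \subset H by rewrite cycle_subG.
  have Hy: y \in H by apply: subsetP xy.
  split; first by rewrite !inE y1.
  rewrite eqEcard cycle_subG xy /= -!orderE; have:= order_dvdG xy.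
  rewrite -orderE dvdn_prime2 ?o_pr // ?inE ?y1 // => /eqP->.
  exact: leqnn.
(* The sum over [H^#] is also [- v], so [#|D| - 1] annihilates [v != 0]; in characteristic 0 this
   leaves a single subgroup in [D], making [H] cyclic. *)
rewrite sum1 // -[X in (X = _)%R]mulr1n => /eqP.
rewrite !mulNrn eqr_opp -subr_eq0 => E.
have /trivgPn[x Hx x1] := ntH.
have Dx: <[x]> \in D by apply: imset_f; rewrite !inE x1.
have D1: #|D| = 1%N.
  have D0: 0 < #|D| by apply/card_gt0P; exists <[x]>.
  move: E; rewrite -opprB oppr_eq0 -mulrnBr // -scaler_nat scaler_eq0.
  rewrite (negPf v0) orbF pnatr_eq0 subn_eq0 => le1.
  by apply/eqP; rewrite eqn_leq le1.
case/negP: ncycH; apply/cyclicP; exists x; apply/eqP.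
rewrite eqEsubset cycle_subG Hx andbT; apply/subsetP=> y Hy.
have [-> | y1] := eqVneq y 1; first exact: group1.
have Dy: <[y]> \in D by apply: imset_f; rewrite !inE y1.
move/eqP/cards1P: D1 Dx Dy => [C ->]; rewrite !inE => /eqP-> /eqP <-.
exact: cycle_id.
Qed.

End FreeAction.

(** * Free representations from functions on the group *)

Section Criterion.

Variables (F : numFieldType) (gT : finGroupType) (G : {group gT}).

Let W : vectType F := {ffun gT -> F^o}.

(** All vanishing conditions are packed into one linear map, so that its kernel [U] is the space
    sought; pairs [u] that carry no condition are sent to 0. *)
Definition norm_fun (f : W) : {ffun gT * gT -> F^o} :=
  [ffun u => if (u.1 \in G) && prime #[u.1]
             then (\sum_(y in <[u.1]>) f (y * u.2)%g)%R else 0%R].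

Lemma norm_fun_is_linear : linear norm_fun.
Proof.
move=> a f g; apply/ffunP=> u; rewrite !ffunE.
case: ifP => _; last by rewrite scaler0 addr0.
by rewrite scaler_sumr -big_split; apply: eq_bigr => y _; rewrite !ffunE.
Qed.
HB.instance Definition _ :=
  GRing.isLinear.Build F W {ffun gT * gT -> F^o} _ norm_fun norm_fun_is_linear.

Definition translate (g : gT) (f : W) : W := [ffun x => f (g^-1 * x)%g].

Lemma translate_is_linear g : linear (translate g).
Proof. by move=> a f h; apply/ffunP=> x; rewrite !ffunE. Qed.
HB.instance Definition _ g :=
  GRing.isLinear.Build F W W _ (translate g) (translate_is_linear g).

Let U := lker (linfun norm_fun).

Lemma norm_kerP (f : W) :
  reflect (forall c x, c \in G -> prime #[c] ->
             \sum_(y in <[c]>) f (y * x)%g = 0)%R (f \in U).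
Proof.
rewrite memv_ker lfunE /=; apply: (iffP eqP) => [f0 c x Gc c_pr | f0].
  by have /ffunP/(_ (c, x)) := f0; rewrite !ffunE Gc c_pr.
by apply/ffunP=> u; rewrite !ffunE; case: ifP => // /andP[]; apply: f0.
Qed.

(** Translation by [g] turns the condition at [c], [x] into the one at [c ^ g], [g^-1 * x]. *)
Lemma translate_ker g f : g \in G -> f \in U -> translate g f \in U.
Proof.
move=> Gg /norm_kerP f0; apply/norm_kerP=> c x Gc c_pr.
rewrite -[RHS](f0 (c ^ g) (g^-1 * x)%g) ?groupJ ?orderJ // cycleJ.
rewrite [RHS](reindex_inj (conjg_inj g)) /=.
apply: eq_big => y; rewrite ?memJ_conjg // => _.
by rewrite ffunE conjgE !mulgA mulgK.
Qed.

(** The projection gives an endomorphism of [U] for every [g]; for [g] in [G] it changes nothing, by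
    [translate_ker]. *)
Definition free_action (g : gT) : subvs_of U -> subvs_of U :=
  fun v => vsproj U (translate g (vsval v)).

Lemma free_action_is_linear g : linear (free_action g).
Proof. by move=> a u v; rewrite /free_action !linearP. Qed.
HB.instance Definition _ g :=
  GRing.isLinear.Build F (subvs_of U) (subvs_of U) _ (free_action g)
    (free_action_is_linear g).

Lemma val_free_action g v : g \in G -> vsval (free_action g v) = translate g (vsval v).
Proof. by move=> Gg; rewrite vsprojK // translate_ker // subvsP. Qed.

Lemma free_representation_of_fun (f : gT -> F) :
    (exists x, f x != 0)%R ->
    (forall c x, c \in G -> prime #[c] -> \sum_(y in <[c]>) f (y * x)%g = 0)%R ->
  exists (V : lmodType F) (rho : gT -> {linear V -> V}),
    free_linear_representation G rho.
Proof.
move=> [x0 fx0] f0; exists (subvs_of U), free_action; split.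
- have Uf : [ffun x => f x] \in U.
    apply/norm_kerP=> c x Gc c_pr; rewrite -[RHS](f0 c x Gc c_pr).
    by apply: eq_bigr => y _; rewrite ffunE.
  exists (Subvs Uf); apply: contra fx0 => /eqP/(congr1 vsval)/ffunP/(_ x0).
  by rewrite !ffunE => ->.
- split=> [v | g h Gg Gh v]; apply: val_inj.
    rewrite /= val_free_action //; apply/ffunP=> x.
    by rewrite ffunE invg1 mul1g.
  rewrite /= !val_free_action ?groupM //; apply/ffunP=> x.
  by rewrite !ffunE invMg mulgA.
move=> g Gg g1 v; apply: contra => /eqP/(congr1 vsval).
rewrite /= val_free_action // => fixv.
(* A function fixed by [g] is constant on each coset [<[g]> x], so the condition at an element of
   prime order [p] of [<[g]>] says that [p] times its value is 0. *)
have fixX x k : vsval v (g ^+ k * x)%g = vsval v x.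
  elim: k => [|k IHk]; first by rewrite mul1g.
  by rewrite -IHk -[in LHS]fixv ffunE expgS !mulgA mulVg mul1g.
have p_pr : prime (pdiv #[g]) by rewrite pdiv_prime ?order_gt1.
have [c gc oc] := Cauchy p_pr (pdiv_dvd #[g]).
have Gc : c \in G by apply: subsetP gc; rewrite cycle_subG.
apply/eqP/val_inj/ffunP=> x; rewrite /= [RHS]ffunE; apply/eqP.
have /norm_kerP/(_ c x Gc) := subvsP v; rewrite oc => /(_ p_pr) /eqP.
rewrite (eq_bigr (fun=> vsval v x)) => [|y cy]; last first.
  have /cycleP[k ->] : y \in <[g]> by apply: subsetP cy; rewrite cycle_subG.
  exact: fixX.
rewrite sumr_const -orderE oc -mulr_natl mulf_eq0 pnatr_eq0.
by rewrite (gtn_eqF (prime_gt0 p_pr)).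
Qed.

End Criterion.

(** * Characters of cyclic groups *)

Section CyclicCharacter.

Variables (F : numClosedFieldType) (gT : finGroupType).

Lemma prim_root_exists n : 0 < n -> exists w : F, (n.-primitive_root w)%R.
Proof.
move=> n_gt0; pose p : {poly F} := ('X^n - 1)%R.
have [r Dp] := closed_field_poly_normal p.
rewrite (monicP _) ?monicXnsubC // scale1r in Dp.
have rn1 : all n.-unity_root%R r.
  by apply/allP=> w; rewrite -root_prod_XsubC -Dp.
have sz_r : n < (size r).+1.
  by rewrite -(size_prod_XsubC r id) -Dp size_XnsubC.
have [|w] := hasP (has_prim_root n_gt0 rn1 _ sz_r); last by exists w.
by rewrite -separable_prod_XsubC -Dp separable_Xn_sub_1 // pnatr_eq0 -lt0n.
Qed.

Lemma faithful_char_exists (Z : {group gT}) : cyclic Z ->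
  exists psi : gT -> F,
    [/\ psi 1 = 1%R, {in Z &, {morph psi : x y / x * y >-> (x * y)%R}}
      & {in Z, forall x, psi x = 1%R -> x = 1}].
Proof.
case/cyclicP=> a defZ; have [w prw] := prim_root_exists (order_gt0 a).
(* Any exponent serves, since [w] and [a] have the same order; off [<[a]>] the default exponent is
   0. *)
pose psi x := (w ^+ odflt ord0 [pick k : 'I_#[a].+1 | (a ^+ k)%g == x])%R.
have psiX k : psi (a ^+ k) = (w ^+ k)%R.
  rewrite /psi; case: pickP => /= [j | /(_ (inord (k %% #[a])))].
    by rewrite eq_expg_mod_order -(eq_prim_root_expr prw) => /eqP.
  by rewrite inordK ?expg_mod_order ?eqxx // ltnS ltnW ?ltn_mod.
exists psi; rewrite defZ; split=> [|x y|x].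
- by rewrite -(expg0 a) psiX.
- by case/cycleP=> i -> /cycleP[j ->]; rewrite -expgD !psiX exprD.
case/cycleP=> i ->; rewrite psiX => /eqP.
by rewrite -(prim_order_dvd prw) order_dvdn => /eqP.
Qed.

Lemma sum_char_cycle (psi : gT -> F) (c : gT) :
  {in <[c]> &, {morph psi : x y / x * y >-> (x * y)%R}} -> psi c != 1%R ->
  (\sum_(y in <[c]>) psi y = 0)%R.
Proof.
move=> psiM psic; set s := (\sum_(y in _) _)%R.
have Es : (psi c * s = s)%R.
  rewrite mulr_sumr [RHS](reindex_inj (mulgI c)) /=.
  by apply: eq_big => [y | y cy]; rewrite ?groupMl ?psiM ?cycle_id.
have /eqP: ((psi c - 1) * s = 0)%R by rewrite mulrBl mul1r Es subrr.
by rewrite mulf_eq0 subr_eq0 (negPf psic) => /eqP.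
Qed.
End CyclicCharacter.

(** * Elements of prime order in semiprime-cyclic groups *)

Section SemiprimeCyclic.

Variables (gT : finGroupType) (G : {group gT}).
Hypothesis spG : semiprime_cyclic G.

(** Otherwise [B <*> <[c]>] has order the square of a prime, hence is cyclic, yet it has two
    distinct subgroups of that prime order. *)
Lemma norm_prime_cycle_mem (B : {group gT}) c :
  B \subset G -> c \in G -> prime #|B| -> #[c] = #|B| -> c \in 'N(B) -> c \in B.
Proof.
move=> sBG Gc pB oc nBc; apply: contraT => notBc.
have tiBc : B :&: <[c]> = 1 by rewrite setIC prime_TIg ?cycle_subG // -orderE oc.
have defK : B <*> <[c]> = B * <[c]> by rewrite norm_joinEr ?cycle_subG.
have cycK : cyclic (B <*> <[c]>)%G.
  apply: spG; first by rewrite join_subG sBG cycle_subG.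
  exists #|B|, #|B|; split=> //=; rewrite defK TI_cardMg //.
  by rewrite -orderE oc.
have := eq_subG_cyclic cycK (joing_subl B <[c]>) (joing_subr B <[c]>).
rewrite -orderE oc eqxx => /eqP defB; case/negP: notBc.
by rewrite (defB : B :=: <[c]>) cycle_id.
Qed.

(** Unless [c] lies in [B], the order of [B <*> <[c]>] is the product of two primes, so this group
    is cyclic, hence abelian. *)
Lemma norm_prime_cycle_cent (B : {group gT}) c :
  B \subset G -> c \in G -> prime #|B| -> prime #[c] -> c \in 'N(B) -> c \in 'C(B).
Proof.
move=> sBG Gc pB pc nBc; have abB : abelian B := cyclic_abelian (prime_cyclic pB).
have [Bc | notBc] := boolP (c \in B); first exact: subsetP abB c Bc.
have defK : B <*> <[c]> = B * <[c]> by rewrite norm_joinEr ?cycle_subG.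
have tiBc : B :&: <[c]> = 1.
  by rewrite setIC prime_TIg -?orderE ?cycle_subG.
have /cyclic_abelian cK : cyclic (B <*> <[c]>)%G.
  apply: spG; first by rewrite join_subG sBG cycle_subG.
  by exists #|B|, #[c]; split=> //=; rewrite defK TI_cardMg.
rewrite -cycle_subG; apply: subset_trans (joing_subr B <[c]>) _.
exact: subset_trans cK (centS (joing_subl _ _)).
Qed.

(** An abelian group of rank at least 2 contains an elementary abelian subgroup of order [p ^ 2],
    which is not cyclic. *)
Lemma abelian_semiprime_cyclic (A : {group gT}) :
  A \subset G -> abelian A -> cyclic A.
Proof.
move=> sAG abA; rewrite abelian_rank1_cyclic // leqNgt; apply/negP.
have [p p_pr ->] := rank_witness A; case/p_rank_geP=> E.
case/pnElemPcard=> sEA abE oE.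
have cycE : cyclic E.
  apply: spG (subset_trans sEA sAG) _; exists p, p; by rewrite oE; split.
by rewrite (abelem_cyclic abE) oE pfactorK in cycE.
Qed.

(** Some central [b] has order [p], and every [x] with [x ^+ p = 1] centralises [<[b]>], hence lies
    in it by [norm_prime_cycle_mem]. *)
Lemma pgroup_Ohm1 p (P : {group gT}) : prime p -> p.-group P -> P \subset G -> P :!=: 1 ->
  #|'Ohm_1(P)| = p /\ 'Ohm_1(P) \subset 'Z(P).
Proof.
move=> p_pr pP sPG ntP; have ntZ: 'Z(P) != 1 by rewrite (center_nil_eq1 (pgroup_nil pP)).
have [_ pdvd _] := pgroup_pdiv (pgroupS (center_sub P) pP) ntZ.
have [b Zb ob] := Cauchy p_pr pdvd; have /centerP[Pb cPb] := Zb.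
suff -> : 'Ohm_1(P) = <[b]>.
  by rewrite -orderE cycle_subG.
rewrite (OhmE 1 pP); apply/eqP; rewrite eqEsubset gen_subG cycle_subG.
rewrite mem_gen ?andbT; last by rewrite !inE Pb -ob /= expg_order eqxx.
apply/subsetP=> x; rewrite !inE => /andP[Px xp].
have [-> | x1] := eqVneq x 1; first exact: group1.
apply: (@norm_prime_cycle_mem <[b]>%G); rewrite ?cycle_subG ?(subsetP sPG) //.
- by rewrite -orderE ob.
- rewrite -orderE ob; apply: nt_prime_order => //; exact/eqP.
by apply: (subsetP (cent_sub _)); rewrite cent_cycle; apply/cent1P; apply: commute_sym; apply: cPb.
Qed.

Lemma pcore_cent_same (p : nat) c : 'O_p(G) != 1 -> c \in G -> prime p -> #[c] = p ->
  c \in 'Z('O_p(G)).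
Proof.
move=> ntP Gc p_pr oc.
have [o1 sZ] := pgroup_Ohm1 p_pr (pcore_pgroup p G) (pcore_sub p G) ntP.
apply: (subsetP sZ); apply: norm_prime_cycle_mem; rewrite ?o1 //.
  exact: subset_trans (Ohm_sub _ _) (pcore_sub _ _).
have : 'Ohm_1('O_p(G)) <| G by apply: char_normal_trans (Ohm_char _ _) (pcore_normal _ _).
by case/andP=> _ /subsetP; apply.
Qed.

End SemiprimeCyclic.

(** By coprime action on an abelian group, [[~: P, A]] meets the fixed points of [A], hence
    ['Ohm_1(P)], trivially. A subgroup of [P] with this property is trivial. *)
Lemma coprime_cent_abelian (gT : finGroupType) (P A : {group gT}) :
    abelian P -> A \subset 'N(P) -> coprime #|P| #|A| ->
  A \subset 'C('Ohm_1(P)) -> A \subset 'C(P).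
Proof.
move=> abP nPA coPA cP1A; have tiP := coprime_abel_cent_TI nPA coPA abP.
have sPAP : [~: P, A] \subset P by rewrite commg_subl.
have : [~: P, A] :&: P = 1.
  by apply: TI_Ohm1; apply/trivgP; rewrite -tiP setIS // centsC.
by rewrite (setIidPl sPAP) commGC => /commG1P.
Qed.

(** Otherwise, with [Z] the intersection of [C] and ['F(G)], some nontrivial abelian [N / Z] inside
    [C / Z] is normal in [G / Z]. As [Z] is central in [N], [N] is nilpotent of class at most 2, so
    it lies in ['F(G)], a contradiction. *)
Lemma solvable_cent_Fitting (gT : finGroupType) (G : {group gT}) :
  solvable G -> 'C_G('F(G)) \subset 'F(G).
Proof.
move=> solG; have nsFG := Fitting_normal G; set C := 'C_G('F(G)).
have nsCG : C <| G.
  by rewrite /normal subsetIl normsI ?normG // norms_cent ?normal_norm.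
set Z := C :&: 'F(G); have nsZG : Z <| G by apply: normalI.
apply/setIidPl/eqP; rewrite eqEsubset subsetIl /= -/Z.
have nZC : C \subset 'N(Z) := subset_trans (normal_sub nsCG) (normal_norm nsZG).
rewrite -quotient_sub1 //; apply/idPn; rewrite subG1 => ntCZ.
have solCZ : solvable (C / Z) by rewrite quotient_sol // (solvableS (normal_sub nsCG)).
have [M [sMCZ nsMG ntM /is_abelemP[p _ /abelem_abelian abM]]] :=
  solvable_norm_abelem solCZ (quotient_normal Z nsCG) ntCZ.
have [N defM sZN nsNG] := inv_quotientN nsZG nsMG.
have sNC : N \subset C.
  rewrite -(quotientSGK _ (subsetIl C 'F(G))) -?defM //.
  exact: subset_trans (normal_sub nsNG) (normal_norm nsZG).
have cZN : N \subset 'C(Z).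
  rewrite centsC (subset_trans (subsetIr _ _)) // centsC.
  exact: subset_trans sNC (subsetIr _ _).
have nilN : nilpotent N.
  apply/lcnP; exists 2; apply/commG1P; rewrite centsC (subset_trans cZN) ?centS //.
  by rewrite der1_min -?defM // (subset_trans sNC).
case/negP: ntM; rewrite defM -subG1 quotient_sub1; last exact: subset_trans sNC nZC.
by rewrite subsetI sNC Fitting_max.
Qed.

(** * Action of elements of prime order on cyclic subgroups and p-cores *)

Section PrimeElements.

Variables (gT : finGroupType) (G : {group gT}).
Hypotheses (spG : semiprime_cyclic G).

(** Coprime action reduces this to the subgroups of prime order of [X], which are characteristic in
    [X]. *)
Lemma prime_cent_cyclic (X : {group gT}) c :
    X \subset G -> cyclic X -> c \in G -> prime #[c] -> coprime #|X| #[c] ->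
  c \in 'N(X) -> c \in 'C(X).
Proof.
move=> sXG cycX Gc pc coXc nXc.
rewrite -cycle_subG; apply: coprime_cent_abelian; rewrite ?cycle_subG //.
  exact: cyclic_abelian.
rewrite /= Ohm1Eprime cent_gen; apply/centP=> b /setIdP[Xb pb].
have sbX : <[b]> \subset X by rewrite cycle_subG.
apply/cent1P; rewrite -cent_cycle.
apply: (norm_prime_cycle_cent spG) => //=; first exact: subset_trans sbX sXG.
by apply: subsetP nXc; rewrite char_norms // sub_cyclic_char.
Qed.

(** A [p]-group whose ['Ohm_1] has order [p] is cyclic or generalised quaternion. As [c] cannot have
    order [p], [prime_cent_cyclic] excludes the cyclic case. *)
Lemma prime_cent_pcore (p : nat) c :
    prime p -> c \in G -> prime #[c] -> c \notin 'C('O_p(G)) ->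
  [/\ p = 2, #[c] != 2 & extremal_class 'O_p(G) = Quaternion].
Proof.
move=> p_pr Gc pc ncPc; set P := 'O_p(G) in ncPc *.
have ntP : P != 1 by apply: contraNneq ncPc => ->; rewrite -cycle_subG cents1.
have pP : p.-group P := pcore_pgroup p G.
have c'p : #[c] != p.
  apply: contraNneq ncPc => oc; have := pcore_cent_same spG ntP Gc p_pr oc.
  by case/setIP.
have [/prime_Ohm1P oP1 _] := pgroup_Ohm1 spG p_pr pP (pcore_sub _ _) ntP.
have := oP1 pP ntP; case/orP=> [cycP | /andP[/eqP Dp /eqP ->]]; last by rewrite -Dp.
case/negP: ncPc; apply: prime_cent_cyclic => //; first exact: pcore_sub.
  by rewrite (pnat_coprime pP) // /pnat order_gt0 primes_prime //= !inE c'p.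
by have /andP[_ /subsetP->] := pcore_normal p G.
Qed.

End PrimeElements.

(** * Automorphisms of order 3 of the quaternion group *)

Lemma quaternion_aut_prime (gT : finGroupType) (Q : {group gT}) c :
    extremal_class Q = Quaternion -> prime #[c] -> #[c] != 2 -> c \in 'N(Q) ->
    c \notin 'C(Q) ->
    (forall X : {group gT}, X \subset Q -> cyclic X -> c \in 'N(X) -> c \in 'C(X)) ->
  [/\ #|Q| = 8, #|'Z(Q)| = 2, #[c] = 3 & 'C_Q[c] = 'Z(Q)].
Proof.
move=> /quaternion_classP[n n_gt2 isoQ] pc c2 nQc ncQc centc.
have [[x y] genQ _] := generators_quaternion n_gt2 isoQ.
have [[_ _ _] [_ _ _ _] [defZ oZ _ _ _] _ big_n] := quaternion_structure n_gt2 genQ isoQ.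
have [oQ Qx ox _] := genQ; set D := 'C_Q[c].
have sDQ : D \subset Q := subsetIl _ _.
have dvdD : #|D| %| 2 ^ n by rewrite -oQ cardSg.
have modQ : #|Q| = #|D| %[mod #[c]].
  have actsQ : [acts <[c]>, on Q | 'J] by rewrite astabsJ cycle_subG.
  have c_group : #[c].-group <[c]> by rewrite /pgroup -orderE pnat_id.
  by rewrite (pgroup_fix_mod c_group actsQ) afixJ cent_cycle.
have odd_dvd k : #[c] %| 2 ^ k -> False.
  by rewrite Euclid_dvdX // => /andP[]; rewrite dvdn_prime2 // (negPf c2).
(* The index of [D] is a power of 2. It is not 1, as [c] does not centralise [Q], nor 2, as [#[c]]
   would then divide [2 ^ n - 2 ^ n.-1], a power of 2. *)
have oD4 : #|D| * 4 %| 2 ^ n.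
  case/dvdn_pfactor: dvdD => // k le_kn oD; rewrite oD -(expnD 2 k 2).
  rewrite dvdn_Pexp2l // addn2; have [eq_kn | neq_kn] := eqVneq k n.
    case/negP: ncQc; have : D == Q by rewrite eqEcard sDQ oD oQ eq_kn leqnn.
    by move/eqP/setIidPl; rewrite -cent_cycle centsC cycle_subG.
  have lt_kn : k < n by rewrite ltn_neqAle neq_kn.
  rewrite ltn_neqAle lt_kn andbT; apply/eqP=> Dn.
  case: (@odd_dvd k); move/eqP: modQ; rewrite oQ oD -Dn expnS mul2n -addnn.
  by rewrite -{3}[(2 ^ k)%N]addn0 eqn_modDl mod0n.
(* For [n > 3] the cyclic subgroup [<[x]>] of index 2 is unique, so [c] normalises and thus
   centralises it, against [oD4]. *)
have n3 : n = 3.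
  apply/eqP; rewrite eqn_leq n_gt2 andbT leqNgt; apply/negP=> n_gt3.
  have [_ _ uniqX] := big_n n_gt3.
  have sxQ : <[x]> \subset Q by rewrite cycle_subG.
  have ix : #|Q : <[x]>| = 2.
    rewrite -divgS // -orderE oQ ox -(ltn_predK n_gt2) expnS mulnK //.
    by rewrite expn_gt0.
  have nxc : c \in 'N(<[x]>).
    rewrite inE; apply/subsetP => t; rewrite (uniqX (<[x]> :^ c)%G) //=.
    - by rewrite cyclicJ cycle_cyclic.
    - by rewrite -(normP nQc) conjSg.
    by rewrite -{1}(normP nQc) indexJg.
  have sxD : <[x]> \subset D.
    rewrite subsetI sxQ -cent_cycle centsC cycle_subG.
    by apply: centc; rewrite ?cycle_cyclic.
  have := subset_leq_card sxD; rewrite -orderE ox leqNgt => /negP[].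
  have m_gt0 : 0 < 2 ^ n.-1 by rewrite expn_gt0.
  have Dm : (2 ^ n = 2 * 2 ^ n.-1)%N by rewrite -expnS (ltn_predK n_gt2).
  rewrite -(ltn_pmul2r (isT : 0 < 4)); rewrite Dm in oD4.
  apply: leq_ltn_trans (dvdn_leq _ oD4) _; first by rewrite muln_gt0 m_gt0.
  by rewrite mulnC ltn_pmul2l.
rewrite {}n3 in oQ oD4 oZ *.
have sZD : 'Z(Q) \subset D.
  rewrite subsetI center_sub -cent_cycle centsC cycle_subG.
  apply: centc; rewrite ?center_sub ?prime_cyclic ?oZ //.
  exact: subsetP (gFnorms _ _) _ nQc.
have oD : #|D| = 2.
  apply/eqP; rewrite eqn_leq -{2}oZ subset_leq_card // andbT.
  by rewrite -(leq_pmul2r (isT : 0 < 4)) (dvdn_leq _ oD4).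
split=> //; last by apply/eqP; rewrite eq_sym eqEcard sZD oD oZ.
(* Here 6 is [#|Q| - #|D|], that is [8 - 2]. *)
have : #[c] %| 6.
  by move/eqP: modQ; rewrite oQ oD eqn_mod_dvd.
by rewrite (Euclid_dvdM 2 3) // !dvdn_prime2 // (negPf c2) => /eqP.
Qed.

(** * Order 3 automorphisms modulo inner ones *)

Section QuaternionAction.

Variables (gT : finGroupType) (Q : {group gT}).
Hypotheses (oQ : #|Q| = 8) (oZ : #|'Z(Q)| = 2).

(** The last clause excludes the trivial action; it makes [c] permute the three nontrivial cosets of
    ['Z(Q)] cyclically, by [order3_conj_coset]. *)
Definition order3_action (c : gT) :=
  [/\ c \in 'N(Q), c ^+ 3 = 1 & 'C_Q[c] = 'Z(Q)].

Lemma order3_actionV c : order3_action c -> order3_action (c ^-1).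
Proof.
by case=> nQc c3 cQc; split; rewrite ?groupV // ?expgVn ?c3 ?invg1 // -cQc -!cent_cycle cycleV.
Qed.

Lemma conjg_center_coset t u : t \in Q -> u \in Q -> t ^ u \in 'Z(Q) :* t.
Proof.
move=> Qt Qu; rewrite mem_rcoset.
have sQ'Z : Q^`(1) \subset 'Z(Q).
  rewrite der1_min ?gFnorm // (@card_p2group_abelian _ 2) //.
  by rewrite card_quotient ?gFnorm // -divgS ?center_sub // oQ oZ.
have -> : t ^ u * t^-1 = [~ t^-1, u^-1] ^ u.
  by rewrite /commg /conjg !invgK !mulgA mulgKV.
rewrite memJ_norm; last by rewrite (subsetP (gFnorm _ _)).
by rewrite (subsetP sQ'Z) // mem_commg ?groupV.
Qed.

Lemma center_set2 z : z \in 'Z(Q) -> z != 1 -> 'Z(Q) = [set 1; z].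
Proof.
move=> Zz z1; apply/esym/eqP; rewrite eqEcard subUset !sub1set group1 Zz.
by rewrite cards2 oZ eq_sym z1.
Qed.

Lemma center_sqr z : z \in 'Z(Q) -> z ^+ 2 = 1.
Proof. by move=> Zz; apply/eqP; rewrite -order_dvdn -oZ order_dvdG. Qed.

(** If [x ^ c = z * x] with [z] central, then [x ^ (c ^+ 2) = z ^+ 2 * x = x], so [c], being
    [c ^+ 2] inverted, fixes [x]. *)
Lemma order3_conj_coset c x :
  order3_action c -> x \in Q -> x ^ c \in 'Z(Q) :* x -> x \in 'Z(Q).
Proof.
case=> nQc c3 cQc Qx; case/rcosetP=> z Zz Exc.
have zc : z ^ c = z.
  by apply/conjg_fixP; apply/commgP; move: Zz; rewrite -cQc => /setIP[_ /cent1P].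
have z2 : z * z = 1 by rewrite -(center_sqr Zz).
have xc2 : x ^ (c ^+ 2) = x by rewrite expgS expg1 conjgM Exc conjMg zc Exc mulgA z2 mul1g.
rewrite -cQc inE Qx; apply/cent1P/commgP/conjg_fixP.
by rewrite -{1}xc2 -conjgM -expgSr c3 conjg1.
Qed.

(** Conjugation by [c] rotates the three factors. Conjugation by [x^-1] does the same, and it fixes
    every coset of ['Z(Q)], so [order3_conj_coset] applies. *)
Lemma order3_norm_center c x :
  order3_action c -> x \in Q -> x ^ (c ^+ 2) * x ^ c * x \in 'Z(Q).
Proof.
move=> act Qx; have [nQc c3 cQc] := act.
have nQX k : c ^+ k \in 'N(Q) by rewrite groupX.
have Qw : x ^ (c ^+ 2) * x ^ c * x \in Q by rewrite 2?groupM ?memJ_norm.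
apply: (order3_conj_coset act) => //.
rewrite 2!conjMg -2!conjgM -expgSr c3 conjg1 -[c * c]/(c ^+ 2).
suff -> : x * x ^ (c ^+ 2) * x ^ c = (x ^ (c ^+ 2) * x ^ c * x) ^ x^-1.
  by apply: conjg_center_coset; rewrite ?groupV.
by move: (x ^ (c ^+ 2)) (x ^ c) => a b; rewrite conjgE invgK !mulgA mulgK.
Qed.

(** The centraliser lies strictly between ['Z(Q)] and [Q], so its order is 4. *)
Lemma noncentral_cent1 x :
  x \in Q -> x \notin 'Z(Q) -> 'Z(Q) :* x = 'C_Q[x] :\: 'Z(Q) /\ #|Q : 'C_Q[x]| = 2.
Proof.
move=> Qx notZx.
have sZC : 'Z(Q) \subset 'C_Q[x].
  by rewrite setIS // -cent_set1 centS // sub1set.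
have Cx : x \in 'C_Q[x] by rewrite inE Qx cent1id.
have ltC : #|'C_Q[x]| < 8.
  rewrite -oQ proper_card // properE subsetIl; apply: contra notZx => sQC.
  rewrite inE Qx; apply/centP=> y Qy; apply/cent1P.
  by have /setIP[] := subsetP sQC y Qy; rewrite cent1C.
have gtC : 2 < #|'C_Q[x]|.
  rewrite -oZ proper_card // properE sZC; apply: contra notZx => sCZ.
  exact: subsetP sCZ x Cx.
have oC : #|'C_Q[x]| = 4.
  have : #|'C_Q[x]| %| 2 ^ 3 by rewrite -[(2 ^ 3)%N]oQ cardSg ?subsetIl.
  case/dvdn_pfactor=> // k _ oC; move: ltC gtC; rewrite {}oC.
  by rewrite (ltn_exp2l k 3) // (ltn_exp2l 1 k) //; case: k => [|[|[|]]].
split; last by rewrite -divgS ?subsetIl // oQ oC.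
apply: rcoset_index2 => //; last by rewrite inE notZx Cx.
by rewrite -divgS // oC oZ.
Qed.

Lemma order3_conj_noncomm c x :
  order3_action c -> x \in Q -> x \notin 'Z(Q) -> x ^ c \notin 'C_Q[x].
Proof.
move=> act Qx notZx; have [nQc _ _] := act.
have [defC _] := noncentral_cent1 Qx notZx.
apply: contra (notZx) => Cxc; apply: (order3_conj_coset act) => //.
rewrite defC inE Cxc andbT; apply: contra notZx => Zxc.
by rewrite -(memJ_norm x (_ : c \in 'N('Z(Q)))) // (subsetP (gFnorms _ _)).
Qed.

Lemma center_fix d z : d \in 'N(Q) -> z \in 'Z(Q) -> z ^ d = z.
Proof.
move=> nQd Zz; have [-> | z1] := eqVneq z 1; first exact: conj1g.
have : z ^ d \in 'Z(Q) by rewrite memJ_norm // (subsetP (gFnorms _ _)).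
by rewrite (center_set2 Zz z1) !inE conjg_eq1 (negPf z1) => /eqP.
Qed.

(** If [d] multiplies [x] by the nontrivial central element, so does any [a] not commuting with [x],
    and the two effects cancel. *)
Lemma conj_center_correct d x a :
    d \in 'N(Q) -> x \in Q -> a \in Q -> a \notin 'C[x] -> x ^ d \in 'Z(Q) :* x ->
  exists2 q, q \in <[a]> & x ^ (d * q) = x.
Proof.
move=> nQd Qx Qa ncax /rcosetP[z1 Zz1 Exd].
have [z11 | nz1] := eqVneq z1 1; first by exists 1; rewrite // mulg1 Exd z11 mul1g.
exists a; first exact: cycle_id.
have /rcosetP[z Zz Exa] := conjg_center_coset Qx Qa.
have nz : z != 1.
  apply: contra ncax => /eqP z_1; rewrite cent1C; apply/cent1P/commgP/conjg_fixP.
  by rewrite Exa z_1 mul1g.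
have Ez : z1 = z.
  by move: Zz1; rewrite (center_set2 Zz nz) !inE (negPf nz1) => /eqP.
have nQa : a \in 'N(Q) by apply: subsetP (normG Q) _ Qa.
rewrite conjgM Exd conjMg (center_fix nQa Zz1) Exa Ez mulgA.
by rewrite -[z * z]/(z ^+ 2) (center_sqr Zz) mul1g.
Qed.

(** The action is corrected on [x] by a power of [a], then on [a] by a power of [x]; neither
    correction disturbs the other element. What results fixes [x], [a] and ['Z(Q)], which generate
    [Q]. *)
Lemma inner_of_center_coset d x a :
    d \in 'N(Q) -> x \in Q -> a \in Q -> a \notin 'C[x] ->
    x ^ d \in 'Z(Q) :* x -> a ^ d \in 'Z(Q) :* a ->
  exists2 q, q \in Q & d * q \in 'C(Q).
Proof.
move=> nQd Qx Qa ncax xd ad.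
have [q1 aq1 fix_x] := conj_center_correct nQd Qx Qa ncax xd.
have Qq1 : q1 \in Q by apply: subsetP aq1; rewrite cycle_subG.
have nQq1 : q1 \in 'N(Q) by apply: subsetP (normG Q) _ Qq1.
have fixq1 : a ^ q1 = a.
  by case/cycleP: aq1 => i ->; apply/conjg_fixP/commgP; apply: commuteX.
have adq1 : a ^ (d * q1) \in 'Z(Q) :* a.
  case/rcosetP: ad => z Zz Ea.
  by rewrite conjgM Ea conjMg fixq1 (center_fix nQq1 Zz) mem_rcoset mulgK.
have nQdq1 : d * q1 \in 'N(Q) by rewrite groupM.
have ncxa : x \notin 'C[a] by rewrite cent1C.
have [q2 xq2 fix_a] := conj_center_correct nQdq1 Qa Qx ncxa adq1.
have Qq2 : q2 \in Q by apply: subsetP xq2; rewrite cycle_subG.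
have nQq2 : q2 \in 'N(Q) by apply: subsetP (normG Q) _ Qq2.
exists (q1 * q2); first by rewrite groupM.
rewrite mulgA.
have {}fix_x : x ^ (d * q1 * q2) = x.
  rewrite conjgM fix_x; case/cycleP: xq2 => i ->.
  by apply/conjg_fixP/commgP; apply: commuteX.
have nQg : d * q1 * q2 \in 'N(Q) by rewrite groupM.
move: (d * q1 * q2) nQg fix_x fix_a => g nQg fix_x fix_a.
have notZx : x \notin 'Z(Q).
  by apply: contra ncxa => /centerP[_ /(_ a Qa) cxa]; apply/cent1P.
have [defC iC] := noncentral_cent1 Qx notZx.
have notCa : a \in Q :\: 'C_Q[x] by rewrite in_setD in_setI (negPf ncax) andbF Qa.
have defQ := rcoset_index2 (subsetIl Q 'C[x]) iC notCa.
have fixC y : y \in 'C_Q[x] -> y ^ g = y.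
  move=> Cy; have [Zy | notZy] := boolP (y \in 'Z(Q)); first exact: center_fix.
  have : y \in 'Z(Q) :* x by rewrite defC inE notZy Cy.
  by case/rcosetP=> z Zz ->; rewrite conjMg fix_x (center_fix nQg).
rewrite -cycle_subG; rewrite centsC; apply/subsetP=> y Qy.
rewrite cent_cycle; apply/cent1P/commgP/conjg_fixP.
have [Cy | notCy] := boolP (y \in 'C_Q[x]); first exact: fixC.
have : y \in 'C_Q[x] :* a by rewrite defQ inE notCy Qy.
by case/rcosetP=> e Ce ->; rewrite conjMg fix_a fixC.
Qed.

(** Both [c] and [c0] permute the three nontrivial cosets of ['Z(Q)] cyclically, so [c] or [c^-1]
    agrees with [c0] on them, and an automorphism fixing these cosets is inner. *)
Lemma order3_action_inner c c0 :
    order3_action c -> order3_action c0 ->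
  exists2 q, q \in Q & (c * c0^-1 * q \in 'C(Q)) || (c^-1 * c0^-1 * q \in 'C(Q)).
Proof.
move=> act act0; have [nQc0 c03 _] := act0.
have [x Qx notZx] : exists2 x, x \in Q & x \notin 'Z(Q).
  apply/subsetPn; apply: contraTN isT => sQZ.
  by have := subset_leq_card sQZ; rewrite oQ oZ.
have [defC iC] := noncentral_cent1 Qx notZx.
pose a := x ^ c0.
have outC e : order3_action e -> x ^ e \in Q :\: 'C_Q[x].
  by move=> acte; have [nQe _ _] := acte; rewrite inE order3_conj_noncomm ?memJ_norm.
have [Qa notCa] := setDP (outC c0 act0).
have defQ := rcoset_index2 (subsetIl Q 'C[x]) iC (outC c0 act0).
have inner e : order3_action e -> x ^ e \in 'Z(Q) :* a ->
  exists2 q, q \in Q & e * c0^-1 * q \in 'C(Q).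
  move=> acte xe; have [nQe e3 _] := acte.
  have nQd : e * c0^-1 \in 'N(Q) by rewrite groupM ?groupV.
  have ncax : a \notin 'C[x] by apply: contra notCa => Ca; rewrite inE Qa.
  apply: (inner_of_center_coset nQd Qx Qa ncax).
    case/rcosetP: xe => z Zz Exe.
    rewrite conjgM Exe conjMg conjgK (center_fix _ Zz) ?groupV //.
    by rewrite mem_rcoset mulgK.
  (* The product of [x ^ (e ^+ 2)], [x ^ e] and [x] is central, likewise for [c0]. Hence agreement
     of [x ^ e] and [x ^ c0] modulo ['Z(Q)] passes to the squares, that is to [a ^ e] and
     [a ^ c0]. *)
  have := order3_norm_center act0 Qx; have := order3_norm_center acte Qx.
  case/rcosetP: xe => z Zz Exe.
  rewrite !expgS !expg0 !mulg1 !conjgM Exe -/a conjMg (center_fix nQe Zz).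
  have /centerP[_ cz] := Zz.
  move=> Zw1 Zw0; have := groupM Zw1 (groupVr Zw0).
  have Qae : a ^ e \in Q by rewrite memJ_norm.
  have E u v b : u \in Q -> z * u * (z * b) * x * (v * b * x)^-1 = u * v^-1.
    move=> Qu; rewrite (cz u Qu) 2!invMg !mulgA !mulgK -(mulgA u).
    by rewrite -[z * z]/(z ^+ 2) (center_sqr Zz) mulg1.
  rewrite {}E // => Zae.
  have nZc0V : c0^-1 \in 'N('Z(Q)) by rewrite groupV (subsetP (gFnorms _ _)).
  by rewrite mem_rcoset -(memJ_norm _ nZc0V) conjMg conjVg conjgK -conjgM in Zae *.
have [xc | notxc] := boolP (x ^ c \in 'Z(Q) :* a).
  by have [q Qq cq] := inner c act xc; exists q; rewrite ?cq.
have [xcV | notxcV] := boolP (x ^ c^-1 \in 'Z(Q) :* a).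
  by have [q Qq cq] := inner _ (order3_actionV act) xcV; exists q; rewrite ?cq ?orbT.
(* In the remaining case [x ^ c] and [x ^ c^-1] both lie in the third coset, so [c^-1] fixes the
   coset of [x ^ c^-1], which would make [x] central. *)
have coset e : order3_action e -> x ^ e \notin 'Z(Q) :* a -> x ^ e \in 'Z(Q) :* (x * a).
  move=> acte notxe; have := outC e acte; rewrite -defQ => /rcosetP[t Ct Exe].
  have [Zt | notZt] := boolP (t \in 'Z(Q)).
    by case/negP: notxe; rewrite Exe mem_rcoset mulgK.
  have : t \in 'Z(Q) :* x by rewrite defC inE notZt Ct.
  by case/rcosetP=> z Zz Et; rewrite Exe Et mem_rcoset -(mulgA z) mulgK.
have xx : x ^ c \in 'Z(Q) :* (x ^ c^-1).
  have /rcoset_eqP-> := coset _ (order3_actionV act) notxcV.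
  exact: coset.
have [nQc c3 _] := act.
case/negP: notZx.
have nZc : c \in 'N('Z(Q)) by rewrite (subsetP (gFnorms _ _)).
rewrite -(memJ_norm x (groupVr nZc)).
apply: (order3_conj_coset (order3_actionV act)); first by rewrite memJ_norm ?groupV.
suff -> : (x ^ c^-1) ^ c^-1 = x ^ c by [].
rewrite -conjgM; congr (x ^ _); rewrite -[LHS]mulg1 -c3 !expgS expg0 mulg1.
by rewrite !mulgA mulgKV mulVg mul1g.
Qed.

End QuaternionAction.

(** * The character of the binary tetrahedral group *)

Lemma sum_cycle3 (V : nmodType) (gT : finGroupType) (c : gT) (f : gT -> V) :
  #[c] = 3 -> (\sum_(y in <[c]>) f y = f 1%g + (f c + f (c ^+ 2)%g))%R.
Proof.
move=> oc; have c1 : c != 1 by rewrite -order_eq1 oc.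
have c2 : c ^+ 2 != 1 by rewrite -order_dvdn oc.
have cc2 : c != c ^+ 2 by rewrite -[X in X != _]expg1 eq_expg_mod_order oc.
have -> : <[c]> = 1 |: (c |: [set c ^+ 2]).
  apply/esym/eqP; rewrite eqEcard !subUset !sub1set group1 cycle_id mem_cycle /=.
  by rewrite -orderE oc !cardsU1 cards1 !inE negb_or ![1 == _]eq_sym c1 c2 cc2.
rewrite !big_setU1 ?big_set1 ?inE ?negb_or ?[1 == _]eq_sym ?c1 ?c2 //.
Qed.

Section BinaryTetrahedral.

Variables (F : numClosedFieldType) (gT : finGroupType) (G Q Z N : {group gT}).
Hypotheses (oQ : #|Q| = 8) (oZQ : #|'Z(Q)| = 2).
Hypotheses (cycZ : cyclic Z) (cQZ : Z \subset 'C(Q)) (sZQZ : 'Z(Q) \subset Z).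
Hypothesis Z3 : ~~ (3 %| #|Z|).
Let H := Q <*> Z.

(** [N] is fixed beforehand: all elements of prime order outside [Z] will generate the same [N] over
    [H], so a single function on [N] handles them all. *)
Definition tetrahedral_generator (c : gT) :=
  [/\ #[c] = 3, order3_action Q c, c \in 'C(Z) & N :=: H <*> <[c]>].

Lemma tetrahedral_generatorV c :
  tetrahedral_generator c -> tetrahedral_generator c^-1.
Proof.
by case=> oc act cZc defN; split; rewrite ?orderV ?cycleV ?groupV //; apply: order3_actionV.
Qed.

Lemma mulQZ : H = Q * Z. Proof. by rewrite /H cent_joinEr. Qed.

Lemma tetrahedral_notin c : tetrahedral_generator c -> c \notin H.
Proof.
case=> oc _ _ _; apply/negP=> Hc.
have : #[c] %| #|Q| * #|Z|.
  by rewrite mul_cardG -mulQZ dvdn_mulr // order_dvdG.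
by rewrite oc Euclid_dvdM // oQ (negPf Z3).
Qed.

Lemma tetrahedral_cube c q t :
    tetrahedral_generator c -> q \in Q -> t \in Z ->
  (c * (q * t)) ^+ 3 = q ^ (c ^+ 2) * q ^ c * q * t ^+ 3.
Proof.
case=> _ [nQc c3 _] cZc _ Qq Zt; rewrite mulgA expgMn; last first.
  apply: commute_sym; apply: commuteM; last exact: (centsP cQZ).
  by apply: commute_sym; apply: (centP cZc).
congr (_ * _); rewrite !conjgE -[c ^- 2]mul1g -c3.
by rewrite !expgS expg0 !mulg1 invMg !mulgA !mulgK.
Qed.

Lemma tetrahedral_cube_mem c h :
  tetrahedral_generator c -> h \in H -> (c * h) ^+ 3 \in Z.
Proof.
move=> genc; rewrite mulQZ => /mulsgP[q t Qq Zt ->].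
rewrite tetrahedral_cube // groupM ?groupX // (subsetP sZQZ) //.
by have [_ act _ _] := genc; apply: order3_norm_center act Qq.
Qed.

Lemma tetrahedral_mem c x :
  tetrahedral_generator c -> x \in N -> exists k, exists2 h, h \in H & x = c ^+ k * h.
Proof.
case=> _ [nQc _ _] cZc ->; have nHc : <[c]> \subset 'N(H).
  by rewrite normsY // cycle_subG // (subsetP (cent_sub _)).
rewrite norm_joinEr // -(normC nHc) => /mulsgP[_ h /cycleP[k ->] Hh ->].
by exists k, h.
Qed.

(** The part of [N] outside [H] consists of the cosets of [c] and [c^-1], and both are generators in
    the above sense. *)
Lemma tetrahedral_cubeN c x :
  tetrahedral_generator c -> x \in N -> x \notin H -> x ^+ 3 \in Z.
Proof.
move=> genc Nx; have [k [h Hh ->]] := tetrahedral_mem genc Nx.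
have [oc [_ c3 _] _ _] := genc.
rewrite -(expg_mod_order c k) oc; have: k %% 3 < 3 by rewrite ltn_mod.
case: (k %% 3) => [|[|[|]]] // _; first by rewrite mul1g Hh.
  by rewrite expg1 => _; apply: tetrahedral_cube_mem.
have -> : c ^+ 2 = c^-1 by apply: (mulIg c); rewrite -expgSr c3 mulVg.
by move=> _; apply: tetrahedral_cube_mem => //; apply: tetrahedral_generatorV.
Qed.

(** The two values differ by the order of the factors [q ^ c] and [q ^ c^-1]. If these commuted,
    conjugating by [c] would make [q ^ c^-1] commute with [q]. *)
Lemma tetrahedral_cube_noncomm c q (w := fun e => q ^ (e ^+ 2) * q ^ e * q) :
  tetrahedral_generator c -> q \in Q -> q \notin 'Z(Q) -> w c^-1 != w c.
Proof.
case=> oc act _ _ Qq notZq; have actV := order3_actionV act.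
have [nQc c3 _] := act.
have c2V : c ^+ 2 = c^-1 by apply: (mulIg c); rewrite -expgSr c3 mulVg.
have cV2 : c^-1 ^+ 2 = c by rewrite expgVn c2V invgK.
have := order3_conj_noncomm oQ oZQ actV Qq notZq; apply: contra.
rewrite /w cV2 c2V (inj_eq (mulIg q)) => /eqP/(congr1 (conjg^~ c)).
rewrite /= (conjMg (q ^ c)) (conjMg (q ^ c^-1)) conjgKV -conjgM -[c * c]/(c ^+ 2) c2V => E.
by rewrite inE memJ_norm ?groupV // Qq; apply/cent1P.
Qed.

Lemma tetrahedral_fun_exists c0 :
    tetrahedral_generator c0 ->
    (forall c, c \in G -> prime #[c] -> c \notin Z -> tetrahedral_generator c) ->
  exists2 f : gT -> F, f 1%g != 0%R
    & forall c x, c \in G -> prime #[c] -> (\sum_(y in <[c]>) f (y * x)%g = 0)%R.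
Proof.
move=> gen0 genG; have [psi [psi1 psiM psi_inj]] := faithful_char_exists F cycZ.
have sZH : Z \subset H by apply: joing_subr.
have sHN : H \subset N by have [_ _ _ ->] := gen0; apply: joing_subl.
have cNZ : N \subset 'C(Z).
  have [_ _ cZc0 ->] := gen0.
  have abZ : Z \subset 'C(Z) := cyclic_abelian cycZ.
  by rewrite !join_subG centsC cQZ abZ cycle_subG.
(* On SL(2, 3), m is up to the sign of x ^+ 3 the character of the quaternionic
   representation: 2 at 1, 0 at elements of order 4, -1 at elements of order 3.
   Cubes of elements of N outside Q Z :\: Z lie in Z, so psi (x ^+ 3) makes
   sense there and restricts to the faithful character psi ^+ 3 on Z. *)
pose m (x : gT) : F := (if x \in Z then 2%:R else if x \in H then 0 else -1)%R.
pose f (x : gT) : F := (if x \in N then m x * psi (x ^+ 3)%g else 0)%R.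
exists f => [|c x Gc pc].
  by rewrite /f /m !group1 expg1n psi1 mulr1 pnatr_eq0.
(* For [c] in [Z], translating by [y] multiplies [f] by [psi (y ^+ 3)], and [psi (c ^+ 3) != 1]
   because the prime [#[c]] is not 3. *)
have [Zc | notZc] := boolP (c \in Z).
  have Zy y : y \in <[c]> -> y \in Z by apply: subsetP; rewrite cycle_subG.
  have fM y : y \in <[c]> -> f (y * x)%g = (psi (y ^+ 3)%g * f x)%R.
    move=> cy; have {cy} Zy := Zy y cy; rewrite /f /m.
    rewrite (groupMl _ Zy) (groupMl _ (subsetP sZH y Zy)).
    rewrite (groupMl _ (subsetP sHN y (subsetP sZH y Zy))).
    case: ifP => Nx; last by rewrite mulr0.
    have cyx : commute y x by apply: commute_sym; apply: (centsP cNZ).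
    case: (boolP (x \in Z)) => [Zx | notZx].
      by rewrite expgMn // psiM ?groupX // mulrCA.
    case: (boolP (x \in H)) => [_ | notHx]; first by rewrite !mul0r mulr0.
    have Zx3 : x ^+ 3 \in Z by apply: tetrahedral_cubeN gen0 Nx notHx.
    have Zy3 : y ^+ 3 \in Z by apply: groupX.
    by rewrite expgMn // psiM // mulrCA.
  rewrite (eq_bigr _ fM) -mulr_suml (@sum_char_cycle _ _ (fun y => psi (y ^+ 3)%g)) ?mul0r //.
    move=> y z /Zy Zy' /Zy Zz.
    have cyz : commute y z by apply: (centsP (cyclic_abelian cycZ)).
    by rewrite expgMn // psiM // groupX.
  apply: contra Z3 => /eqP/psi_inj; rewrite groupX // => /(_ isT)/eqP.
  rewrite -order_dvdn dvdn_prime2 // => /eqP <-; exact: order_dvdG.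
have genc := genG c Gc pc notZc; have [oc act cZc defN] := genc.
have [nQc c3 _] := act; have Nc : c \in N by rewrite defN -cycle_subG joing_subr.
have [Nx | notNx] := boolP (x \in N); last first.
  rewrite big1 // => y cy; rewrite /f groupMl ?(negPf notNx) //.
  by apply: subsetP cy; rewrite cycle_subG.
have [k [h Hh ->]] := tetrahedral_mem genc Nx.
transitivity (\sum_(y in <[c]>) f (y * h)%g)%R.
  rewrite [RHS](reindex_inj (mulIg (c ^+ k))) /=.
  by apply: eq_big => [y | y _]; rewrite ?groupMr ?mem_cycle // mulgA.
have c2V : c ^+ 2 = c^-1 by apply: (mulIg c); rewrite -expgSr c3 mulVg.
have notHe e : tetrahedral_generator e -> e \in N -> f (e * h)%g = (- psi ((e * h) ^+ 3)%g)%R.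
  move=> gene Ne; have notHeh : e * h \notin H by rewrite groupMr // tetrahedral_notin.
  have Neh : e * h \in N by rewrite groupM // (subsetP sHN).
  rewrite /f Neh /m (negPf notHeh).
  by rewrite (contraNF (subsetP sZH _) notHeh) mulN1r.
have gencV := tetrahedral_generatorV genc.
rewrite sum_cycle3 // mul1g c2V !notHe ?groupV // {1}/f (subsetP sHN) // /m Hh.
(* For [h] in [Z] all three cubes equal [h ^+ 3], and the coefficients 2, -1, -1 add up to 0. *)
have [Zh | notZh] := boolP (h \in Z).
  have ceh e : tetrahedral_generator e -> (e * h) ^+ 3 = h ^+ 3.
    case=> _ [_ e3 _] cZe _; rewrite expgMn ?e3 ?mul1g //; exact: (centP cZe).
  by rewrite !ceh // -opprD -mulr2n mulr_natl subrr.
(* Here [f h = 0], and the cubes of [c * h] and [c^-1 * h] differ by the nontrivial element of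
   ['Z(Q)], where [psi] is -1, so the other two terms cancel. *)
rewrite mul0r add0r -opprD; apply/eqP; rewrite oppr_eq0.
move: Hh notZh; rewrite mulQZ => /mulsgP[q t Qq Zt ->] notZqt.
have notZq : q \notin 'Z(Q).
  by apply: contra notZqt => Zq; rewrite groupM // (subsetP sZQZ).
rewrite !tetrahedral_cube //; set w1 := _ * q; set w2 := _ * q.
have Zw1 : w1 \in 'Z(Q) by apply: order3_norm_center act Qq.
have Zw2 : w2 \in 'Z(Q) by apply: order3_norm_center (order3_actionV act) Qq.
have w21 : w2 != w1 by apply: tetrahedral_cube_noncomm.
have Zv : w2 * w1^-1 \in 'Z(Q) by rewrite groupM ?groupV.
have : psi (w2 * w1^-1) = (-1)%R.
  have : (psi (w2 * w1^-1)%g ^+ 2 == 1)%R.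
    by rewrite expr2 -psiM ?(subsetP sZQZ) // -[_ * _]/(_ ^+ 2) (center_sqr oZQ) // psi1.
  rewrite sqrf_eq1 => /orP[] /eqP // /psi_inj; rewrite (subsetP sZQZ) // => /(_ isT).
  by move/(canRL (mulgKV _)); rewrite mul1g => E; rewrite E eqxx in w21.
have psiMt w : w \in 'Z(Q) -> psi (w * t ^+ 3)%g = (psi w * psi (t ^+ 3)%g)%R.
  by move=> Zw; rewrite psiM ?groupX // (subsetP sZQZ).
move=> psiv; rewrite !psiMt // -mulrDl -[w2](mulgKV w1).
rewrite (psiM _ _ (subsetP sZQZ _ Zv) (subsetP sZQZ _ Zw1)) psiv.
by rewrite mulN1r subrr mul0r.
Qed.

End BinaryTetrahedral.

(** * The function [f] on a solvable group *)

Section Solvable.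

Variables (F : numClosedFieldType) (gT : finGroupType) (G : {group gT}).
Hypotheses (solG : solvable G) (spG : semiprime_cyclic G).
Let Q : {group gT} := 'O_2(G)%G.
Let Z : {group gT} := 'C_G('F(G))%G.

Lemma cent_pcores_mem c :
  c \in G -> (forall p : nat, prime p -> c \in 'C('O_p(G))) -> c \in Z.
Proof.
move=> Gc cOc; rewrite inE Gc -cycle_subG centsC FittingEgen gen_subG.
apply/bigcupsP=> p; rewrite mem_primes => /and3P[p_pr _ _].
by rewrite centsC cycle_subG cOc.
Qed.

(** By solvability [Z] lies in ['F(G)], which it centralises, so it is abelian. *)
Lemma cyclic_cent_Fitting : cyclic Z.
Proof.
apply: (abelian_semiprime_cyclic spG); first exact: subsetIl.
by rewrite /abelian subIset // centS ?orbT // solvable_cent_Fitting.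
Qed.

(** The cores for odd primes are centralised anyway, by [prime_cent_pcore]. *)
Lemma prime_cent_pcore2_mem c :
  c \in G -> prime #[c] -> c \in 'C(Q) -> c \in Z.
Proof.
move=> Gc pc cQc; apply: cent_pcores_mem => // p p_pr; apply: contraT => ncc.
have [p2 _ _] := prime_cent_pcore spG p_pr Gc pc ncc.
by case/negP: ncc; rewrite p2.
Qed.

Lemma free_fun_cyclic :
    (forall c, c \in G -> prime #[c] -> c \in Z) ->
  exists2 f : gT -> F, f 1%g != 0%R
    & forall c x, c \in G -> prime #[c] -> (\sum_(y in <[c]>) f (y * x)%g = 0)%R.
Proof.
move=> GZ; have [psi [psi1 psiM psi_inj]] := faithful_char_exists F cyclic_cent_Fitting.
exists (fun x => if x \in Z then psi x else 0%R) => [|c x Gc pc].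
  by rewrite group1 psi1 oner_neq0.
have Zc := GZ c Gc pc; have scZ : <[c]> \subset Z by rewrite cycle_subG.
have [Zx | notZx] := boolP (x \in Z); last first.
  by rewrite big1 // => y cy; rewrite (groupMl _ (subsetP scZ y cy)) (negPf notZx).
rewrite (eq_bigr (fun y => psi y * psi x)%R) => [|y cy]; last first.
  by have Zy := subsetP scZ y cy; rewrite groupM ?psiM.
rewrite -mulr_suml sum_char_cycle ?mul0r //; first exact: (sub_in2 (subsetP scZ)).
apply: contraTneq pc => /psi_inj-> //.
by rewrite order1.
Qed.

Lemma noncentral_prime_elt c :
    c \in G -> prime #[c] -> c \notin Z ->
  [/\ #|Q| = 8, #|'Z(Q)| = 2, #[c] = 3 & order3_action Q c].
Proof.
move=> Gc pc notZc.
have ncQc : c \notin 'C(Q) by apply: contra notZc; apply: prime_cent_pcore2_mem.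
have [_ c2 qQ] := prime_cent_pcore spG (isT : prime 2) Gc pc ncQc.
have nQc : c \in 'N(Q) by apply: subsetP (normal_norm (pcore_normal _ _)) _ Gc.
have [|oQ oZ oc cQc] := quaternion_aut_prime qQ pc c2 nQc ncQc.
  move=> X sXQ cycX; apply: (prime_cent_cyclic spG) => //.
    exact: subset_trans sXQ (pcore_sub _ _).
  apply: pnat_coprime (pgroupS sXQ (pcore_pgroup 2 G)) _.
  by rewrite /pnat order_gt0 primes_prime //= !inE c2.
by split=> //; split=> //; rewrite -oc expg_order.
Qed.

Lemma pcore2_sub_Fitting : Q \subset 'F(G).
Proof. by rewrite Fitting_max ?pcore_normal ?(pgroup_nil (pcore_pgroup _ _)). Qed.

Lemma center_pcore2_sub : #|'Z(Q)| = 2 -> 'Z(Q) \subset Z.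
Proof.
move=> oZ; apply/subsetP=> z Zz; have [-> | z1] := eqVneq z 1; first exact: group1.
have /centerP[Qz cQz] := Zz.
apply: prime_cent_pcore2_mem; first exact: subsetP (pcore_sub _ _) z Qz.
  by rewrite (@nt_prime_order _ 2) //; apply/eqP; rewrite -order_dvdn -oZ order_dvdG.
by apply/centP=> y Qy; apply: cQz.
Qed.

(** For [e] one of [c], [c^-1] and some [q] in [Q], [e * c0^-1 * q] centralises [Q]. Each factor
    centralises the odd cores, so this product lies in [Z]. *)
Lemma noncentral_prime_elt_cycle c c0 :
    c \in G -> prime #[c] -> c \notin Z ->
    c0 \in G -> prime #[c0] -> c0 \notin Z ->
  c \in (Q <*> Z) <*> <[c0]>.
Proof.
move=> Gc pc notZc Gc0 pc0 notZc0.
have [oQ oZ oc act] := noncentral_prime_elt Gc pc notZc.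
have [_ _ oc0 act0] := noncentral_prime_elt Gc0 pc0 notZc0.
have [q Qq cqQ] := order3_action_inner oQ oZ act act0.
have Gq : q \in G by apply: subsetP (pcore_sub _ _) q Qq.
set K := (Q <*> Z) <*> <[c0]>.
have Kq : q \in K by rewrite mem_gen // inE mem_gen // inE Qq.
have Kc0 : c0 \in K by rewrite mem_gen // inE cycle_id orbT.
have cent_odd p c1 : prime p -> p != 2 -> c1 \in G -> prime #[c1] -> c1 \in 'C('O_p(G)).
  move=> p_pr p2 Gc1 pc1; apply: contraT => ncc.
  by have [Dp _ _] := prime_cent_pcore spG p_pr Gc1 pc1 ncc; rewrite Dp in p2.
have memZ e : e \in G -> prime #[e] -> e * c0^-1 * q \in 'C(Q) -> e \in K.
  move=> Ge pe cQ; suff Zg : e * c0^-1 * q \in Z.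
    have Kg : e * c0^-1 * q \in K by rewrite mem_gen // inE mem_gen // inE Zg orbT.
    by move: Kg; rewrite groupMr // groupMr // groupV.
  apply: cent_pcores_mem => [|p p_pr]; first by rewrite !groupM ?groupV.
  have [-> // | p2] := eqVneq p 2.
  have sQC : Q \subset 'C('O_p(G)).
    apply: (sub_nilpotent_cent2 (Fitting_nil G)); last 1 first.
    - apply: pnat_coprime (pcore_pgroup p G) _.
      apply: sub_in_pnat (pcore_pgroup 2 G) => r _; rewrite !inE => /eqP->.
      by rewrite eq_sym.
    - by rewrite Fitting_max ?pcore_normal ?(pgroup_nil (pcore_pgroup _ _)).
    exact: pcore2_sub_Fitting.
  by rewrite (groupM _ (subsetP sQC q Qq)) // groupM ?groupV // cent_odd.
case/orP: cqQ; first exact: memZ.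
by move/memZ; rewrite !groupV orderV; apply.
Qed.

Lemma free_fun_exists :
  exists2 f : gT -> F, f 1%g != 0%R
    & forall c x, c \in G -> prime #[c] -> (\sum_(y in <[c]>) f (y * x)%g = 0)%R.
Proof.
have [c0 /and3P[Gc0 pc0 notZc0] | noc] :=
  pickP [pred c | [&& c \in G, prime #[c] & c \notin Z]]; last first.
  apply: free_fun_cyclic => c Gc pc.
  by apply: contraFT (noc c) => notZc; rewrite /= Gc pc.
have [oQ oZQ oc0 _] := noncentral_prime_elt Gc0 pc0 notZc0.
have nsZG : Z <| G.
  by rewrite /normal subsetIl normsI ?normG // norms_cent ?normal_norm ?Fitting_normal.
have cQZ : Z \subset 'C(Q).
  by rewrite (subset_trans (subsetIr _ _)) // centS // pcore2_sub_Fitting.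
have Z3 : ~~ (3 %| #|Z|).
  (* A subgroup of order 3 of the cyclic normal subgroup [Z] is normal in [G], so it would contain
     [c0], of order 3. *)
  apply: contra notZc0 => /(Cauchy (isT : prime 3))[b Zb ob].
  have sbZ : <[b]> \subset Z by rewrite cycle_subG.
  apply: (subsetP sbZ); apply: (norm_prime_cycle_mem spG); rewrite -?orderE ?ob //.
    exact: subset_trans sbZ (normal_sub nsZG).
  have : <[b]> <| G by rewrite (char_normal_trans _ nsZG) // sub_cyclic_char // cyclic_cent_Fitting.
  by case/andP=> _ nbG; apply: (subsetP nbG).
pose N := ((Q <*> Z) <*> <[c0]>)%G.
have gen c : c \in G -> prime #[c] -> c \notin Z -> tetrahedral_generator Q Z N c.
  move=> Gc pc notZc; have [_ _ oc act] := noncentral_prime_elt Gc pc notZc.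
  split=> //.
    apply: (prime_cent_cyclic spG) => //.
    - exact: normal_sub.
    - exact: cyclic_cent_Fitting.
    - by rewrite coprime_sym oc prime_coprime.
    by apply: subsetP (normal_norm nsZG) _ Gc.
  (* Each of [c], [c0] lies in the group generated by [Q], [Z] and the other, so both give the same
     [N]. *)
  by apply/eqP; rewrite eqEsubset; apply/andP; split;
    rewrite join_subG joing_subl cycle_subG noncentral_prime_elt_cycle.
apply: (@tetrahedral_fun_exists F gT G Q Z N oQ oZQ cyclic_cent_Fitting cQZ
  (center_pcore2_sub oZQ) Z3 c0) => //; exact: gen.
Qed.

End Solvable.

Theorem theorem175 (R : realType) (gT : finGroupType) (G : {group gT})
    (solG : solvable G) :
  semiprime_cyclic G <-> freely_representable R G.
Proof.
split=> [spG | [V [rho freeV]]]; last exact: free_semiprime_cyclic freeV.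
have [f f1 f0] := @free_fun_exists R[i] gT G solG spG.
by apply: free_representation_of_fun f0; exists 1%g.
Qed.
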